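(* Let $n\ge1$, $r,z\ge0$ be integers with $k:=n-r-z\ge1$, let $N$ be the least common multiple of $\{n-z-r,n-z-r+1,\dots,n-z\}$, let $q$ be a prime power such that $\mathbb{F}_q$ has at least $nN(k+r)$ distinct non-zero elements, and let $\mathcal{Q}=\mathbb{F}_q^{N(k+r)}$. The random linear encoding scheme described in the context is a rate-optimal $(n,k,r,z)_{\mathcal{Q}}$ secret sharing scheme with high probability (as the field size $q$ grows). Specifically, the scheme meets the security requirement deterministically, and meets the reliability requirement with probability at least $1-\frac{2^n}{q-1}$ over the distribution of the random matrices $R_1,\dots,R_{N(k+r)}$. The scheme achieves the optimal decoding bandwidth when $d$ nodes participate in decoding, universally for all $n-r\le d\le n$.
   Context: Notation: $[n]=\{1,\dots,n\}$; $\bm{c}_I=(c_i)_{i\in I}$; $H$ is Shannon entropy, and all logarithms are to base $Q=|\mathcal{Q}|$. The $n$ shares are stored at $n$ nodes, one share per node. An $(n,k,r,z)_{\mathcal{Q}}$ secret sharing scheme consists of a randomized encoding function mapping a secret $\bm{m}\in\mathcal{Q}^k$ to shares $\bm{c}=(c_1,\dots,c_n)\in\mathcal{Q}^n$ such that (Reliability) $H(\bm{m}\mid\bm{c}_I)=0$ for all $I\subset[n]$ with $|I|=n-r$, and (Secrecy, also called security) $H(\bm{m}\mid\bm{c}_I)=H(\bm{m})$ for all $I\subset[n]$ with $|I|=z$. Every such scheme has $k\le n-r-z$; it is rate-optimal if $k=n-r-z$. Decoding bandwidth: for $I\subset[n]$ with $|I|\ge n-r$ (the set of available nodes), preprocessing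 functions are maps $E_{I,i}:\mathcal{Q}\to\mathcal{S}_{I,i}$ for $i\in I$, with $|\mathcal{S}_{I,i}|\le|\mathcal{Q}|$, and a decoding function is a map $D_I:\prod_{i\in I}\mathcal{S}_{I,i}\to\mathcal{Q}^k$ with $D_I\big((E_{I,i}(c_i))_{i\in I}\big)=\bm{m}$. The communication overhead is $\mathrm{CO}(I)=\sum_{i\in I}\log|\mathcal{S}_{I,i}|-k$, and the decoding bandwidth is $\mathrm{CO}(I)+k$. For every $(n,k,r,z)_{\mathcal{Q}}$ scheme with preprocessing and decoding functions, $\mathrm{CO}(I)\ge \frac{kz}{|I|-z}$. Achieving the optimal decoding bandwidth when $d$ nodes participate in decoding means that $\mathrm{CO}(I)=\frac{kz}{|I|-z}$ for every $I\subset[n]$ with $|I|=d$. The encoding scheme. The $j$-th share is $c_j=(c_{1,j},\dots,c_{N(k+r),j})\in\mathbb{F}_q^{N(k+r)}$. The secret is regarded as a vector $\bm{m}\in\mathbb{F}_q^{Nk(k+r)}$ (identified with $\mathcal{Q}^k$). The encoder generates uniformly distributed random vectors $\bm{k}\in\mathbb{F}_q^{Nkz}$ and $\bm{k}'\in\mathbb{F}_q^{Nrz}$, independent of each other and of $\bm{m}$. With $N(kn+rz)\times n$ matrices $G_1,\dots,G_{N(k+r)}$ over $\mathbb{F}_q$, $$(c_{i,1},\dots,c_{i,n})=(\bm{m}\ \bm{k}\ \bm{k}')\,G_i,\qquad i=1,\dots,N(k+r).$$ Let $\alpha_{v,i}$ ($1\le v\le n$, $1\le i\le N(k+r)$) be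 distinct non-zero elements of $\mathbb{F}_q$. Each $G_i$ is, in block rows from top to bottom, $G_i=\begin{pmatrix} R_i \\ V_i \\ \bm{0} \end{pmatrix}$, where: for $1\le i\le Nk$, $R_i$ has size $Nk(k+r)\times n$, $V_i$ has size $Nkz\times n$ with $(u,v)$ entry $\alpha_{v,i}^{u-1}$, and the zero block has $Nrz$ rows; for $i=Nk+i'$ with $1\le i'\le Nr$, $R_i$ has size $(Nkn+(i'-1)z)\times n$, $V_i$ has size $z\times n$ with $(u,v)$ entry $\alpha_{v,i}^{u-1}$, and the zero block has $(Nr-i')z$ rows. The entries of all the $R_i$ are i.i.d. uniform over $\mathbb{F}_q$. The $R_i$ are part of the code design: the requirements are evaluated for the fixed realization of the $R_i$, and ''deterministically'' means for every realization. The decoding scheme. For $I\subset[n]$ with $|I|\ge n-r$, put $\delta=\frac{Nk(n-|I|)}{|I|-z}$, which is an integer satisfying $(Nk+\delta)|I|=Nkn+\delta z$. The preprocessing function of node $i\in I$ outputs the first $Nk+\delta$ symbols of its share, $E_{I,i}(c_i)=(c_{1,i},\dots,c_{Nk+\delta,i})\in\mathcal{S}_{I,i}=\mathbb{F}_q^{Nk+\delta}$. The user decodes by solving the resulting square linear system of $(Nk+\delta)|I|$ equations for $\bm{m}$, $\bm{k}$ and the first $\delta z$ entries of $\bm{k}'$. *)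

(* Defs.v *)
From HB Require Import structures.
From mathcomp Require Import all_boot all_order all_algebra.
From mathcomp Require Import boolp reals exp.

Set Implicit Arguments.
Unset Strict Implicit.
Unset Printing Implicit Defensive.

Import Order.TTheory GRing.Theory Num.Theory.
Local Open Scope ring_scope.

(* [R : realType] is only used for probabilities and entropies.
   Indices are 0-based throughout. *)

Section FiniteProbability.
Variable R : realType.

Record fdist (T : finType) := FDist {
  pmf :> T -> R;
  pmf_ge0 : forall x, 0 <= pmf x;
  pmf_sum1 : \sum_x pmf x = 1 }.

Section Uniform.
Variables (T : finType) (x0 : T).

Fact uniform_ge0 (x : T) : 0 <= (#|T|%:R : R)^-1.
Proof. by rewrite invr_ge0 ler0n. Qed.

Fact uniform_sum1 : \sum_(x : T) (#|T|%:R : R)^-1 = 1.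
Proof.
rewrite sumr_const -[LHS]mulr_natl mulfV // pnatr_eq0 -lt0n.
by apply/card_gt0P; exists x0.
Qed.

(* [x0] only witnesses that [T] is nonempty. *)
Definition uniform : fdist T := FDist uniform_ge0 uniform_sum1.
End Uniform.

Section Product.
Variables (T U : finType) (p : fdist T) (q : fdist U).

Fact indep_ge0 (x : T * U) : 0 <= p x.1 * q x.2.
Proof. by rewrite mulr_ge0 ?pmf_ge0. Qed.

Fact indep_sum1 : \sum_(x : T * U) p x.1 * q x.2 = 1.
Proof.
rewrite -(pair_bigA _ (fun a b => p a * q b)) /=.
under eq_bigr => a _ do rewrite -big_distrr /= pmf_sum1 mulr1.
exact: pmf_sum1.
Qed.

Definition indep : fdist (T * U)%type := FDist indep_ge0 indep_sum1.
End Product.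

Definition Pr (T : finType) (p : fdist T) (E : T -> Prop) : R :=
  \sum_(x | `[< E x >]) p x.

Section Entropy.
(* Entropies of finite random variables X, Y on (Om, p), to base b;
   [ln 0 = 0] in the library, so null outcomes contribute 0. *)
Variables (b : R) (Om : finType) (p : fdist Om).

Definition logb (x : R) : R := ln x / ln b.

Definition law (A : finType) (X : Om -> A) (x : A) : R :=
  \sum_(w | X w == x) p w.

Definition entropy (A : finType) (X : Om -> A) : R :=
  - \sum_x law X x * logb (law X x).

Definition cond_entropy (A B : finType) (X : Om -> A) (Y : Om -> B) : R :=
  - \sum_y \sum_x
      law (fun w => (X w, Y w)) (x, y) *
      logb (law (fun w => (X w, Y w)) (x, y) / law Y y).
End Entropy.
End FiniteProbability.

Section SecretSharing.
Variables (R : realType) (n k : nat) (Q : finType).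

Definition secret := {ffun 'I_k -> Q}.
Definition shares := {ffun 'I_n -> Q}.

(* A randomized encoding function: [enc] fed with a random key that is drawn
   independently of the secret. *)
Record encoding := Encoding {
  key : finType;
  key_dist : fdist R key;
  enc : secret -> key -> shares }.

Definition restrict (I : {set 'I_n}) (c : shares) :
    {ffun {i : 'I_n | i \in I} -> Q} :=
  [ffun i => c (val i)].

(* The requirements are imposed for every distribution [p] of the secret. *)
Definition reliable (r : nat) (S : encoding) : Prop :=
  forall (p : fdist R secret) (I : {set 'I_n}), #|I| = (n - r)%N ->
    cond_entropy #|Q|%:R (indep p (key_dist S))
      fst (fun w => restrict I (enc w.1 w.2)) = 0.

Definition secure (z : nat) (S : encoding) : Prop :=
  forall (p : fdist R secret) (I : {set 'I_n}), #|I| = z ->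
    cond_entropy #|Q|%:R (indep p (key_dist S))
      fst (fun w => restrict I (enc w.1 w.2))
    = entropy #|Q|%:R (indep p (key_dist S)) fst.

Definition secret_sharing (r z : nat) (S : encoding) : Prop :=
  reliable r S /\ secure z S.

Definition rate_optimal_secret_sharing (r z : nat) (S : encoding) : Prop :=
  secret_sharing r z S /\ k = (n - r - z)%N.

(* Preprocessing functions E_{I,i} and decoding functions D_I; only the sets I
   of at least n - r available nodes matter. *)
Record decoding := Decoding {
  piece : {set 'I_n} -> 'I_n -> finType;
  preprocess : forall (I : {set 'I_n}) (i : 'I_n), Q -> piece I i;
  decode : forall I : {set 'I_n},
    (forall i : {i : 'I_n | i \in I}, piece I (val i)) -> secret }.

Definition decodes (S : encoding) (D : decoding) (I : {set 'I_n}) : Prop :=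
  (forall i, i \in I -> (#|piece D I i| <= #|Q|)%N) /\
  (forall (m : secret) (w : key S), 0 < key_dist S w ->
     decode (fun i : {i : 'I_n | i \in I} =>
               preprocess D I (val i) (enc m w (val i))) = m).

Definition comm_overhead (D : decoding) (I : {set 'I_n}) : R :=
  \sum_(i in I) logb #|Q|%:R #|piece D I i|%:R - k%:R.

Definition optimal_bandwidth (z : nat) (D : decoding) (d : nat) : Prop :=
  forall I : {set 'I_n}, #|I| = d ->
    comm_overhead D I = (k * z)%:R / (#|I|%:R - z%:R).
End SecretSharing.

Definition subpacketization (n r z : nat) : nat :=
  \big[lcmn/1%N]_(n - z - r <= i < (n - z).+1) i.

(* Truncates a vector to its first [p] entries, or pads it with zeros. *)
Definition resize (F : finFieldType) (l p : nat) (x : 'rV[F]_l) : 'rV[F]_p :=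
  \row_(a < p) (if insub (a : nat) is Some b then x 0 (b : 'I_l) else 0).

Section Scheme.
Variables (R : realType) (n k r z N : nat) (F : finFieldType).

Definition share_len : nat := (N * (k + r))%N.

Definition symbol : finType := 'rV[F]_share_len.

Variable alpha : 'I_n -> 'I_share_len -> F.

Definition R_rows (i : 'I_share_len) : nat :=
  if (i < N * k)%N then (k * share_len)%N
  else (k * share_len + N * k * z + (i - N * k) * z)%N.

Definition V_rows (i : 'I_share_len) : nat :=
  if (i < N * k)%N then (N * k * z)%N else z.

Definition realization := {dffun forall i : 'I_share_len, 'M[F]_(R_rows i, n)}.

Definition realization0 : realization := finfun (fun i => 0).

(* All entries of the R_i i.i.d. uniform over F, i.e. a uniform realization. *)
Definition realization_dist : fdist R realization := uniform R realization0.

(* (m k k'); with n = k + r + z its length is N(kn + rz). *)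
Definition input_len : nat := (k * share_len + N * k * z + N * r * z)%N.

Definition G (Rs : realization) (i : 'I_share_len) : 'M[F]_(input_len, n) :=
  \matrix_(u < input_len, v < n)
    if insub (u : nat) is Some u' then Rs i (u' : 'I_(R_rows i)) v
    else if (u < R_rows i + V_rows i)%N then alpha v i ^+ (u - R_rows i)
    else 0.

Definition share (Rs : realization) (x : 'rV[F]_input_len) (j : 'I_n) :
    'rV[F]_share_len :=
  \row_(i < share_len) (x *m G Rs i) 0 j.

(* The identification of Q^k with F^(Nk(k+r)), by concatenation. *)
Definition flatten_secret (m : secret k symbol) : 'rV[F]_(k * share_len) :=
  mxvec (\matrix_(t, a) (m t : 'rV[F]_share_len) 0 a).

Definition unflatten_secret (v : 'rV[F]_(k * share_len)) : secret k symbol :=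
  [ffun t => row t (vec_mx v)].

Definition scheme_key : finType := ('rV[F]_(N * k * z) * 'rV[F]_(N * r * z))%type.

Definition scheme (Rs : realization) : encoding R n k symbol :=
  {| key := scheme_key;
     key_dist := uniform R ((0, 0) : scheme_key);
     enc := fun m w =>
       [ffun j => share Rs (row_mx (row_mx (flatten_secret m) w.1) w.2) j] |}.

(* The division is exact for n - r <= |I|, see [delta_exact]. *)
Definition delta (I : {set 'I_n}) : nat := (N * k * (n - #|I|) %/ (#|I| - z))%N.

Definition scheme_piece (I : {set 'I_n}) : finType := 'rV[F]_(N * k + delta I).

(* The unknown y collects m, k and the first delta * z entries of k'. The other
   entries of k' have zero coefficients in the equations used, so they are
   padded with 0. *)
Definition solves (Rs : realization) (I : {set 'I_n})
    (s : {i : 'I_n | i \in I} -> scheme_piece I)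
    (y : 'rV[F]_(k * share_len + N * k * z + delta I * z)) : bool :=
  [forall i : {i : 'I_n | i \in I},
    s i == resize (N * k + delta I) (share Rs (resize input_len y) (val i))].

Definition scheme_decoding (Rs : realization) : decoding n k symbol :=
  {| piece := fun I _ => scheme_piece I;
     preprocess := fun I _ c => resize (N * k + delta I) c;
     decode := fun I s =>
       unflatten_secret (lsubmx (lsubmx (odflt 0 [pick y | solves Rs s y]))) |}.
End Scheme.

Lemma dvdn_subpacketization (n r z d : nat) :
  (n - z - r <= d <= n - z)%N -> (d %| subpacketization n r z)%N.
Proof.
move=> /andP[ld du]; rewrite /subpacketization (big_cat_nat (n := d)) //=; last first.
  exact: leqW.
rewrite [X in lcmn _ X]big_ltn //; apply: dvdn_trans (dvdn_lcmr _ _).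
exact: dvdn_lcml.
Qed.

Lemma delta_exact (n r z : nat) (I : {set 'I_n}) :
  let k := (n - r - z)%N in let N := subpacketization n r z in
  (0 < k)%N -> (n - r <= #|I|)%N ->
  (delta k z N I * (#|I| - z) = N * k * (n - #|I|))%N /\
  ((N * k + delta k z N I) * #|I| = N * k * n + delta k z N I * z)%N.
Proof.
move=> k N k_gt0 ler.
have In : (#|I| <= n)%N by rewrite -[X in (_ <= X)%N]card_ord max_card.
have lzr : (z < n - r)%N by rewrite -subn_gt0.
have lz : (z <= #|I|)%N by apply: ltnW; apply: leq_trans ler.
have dvN : (#|I| - z %| N)%N.
  apply: dvdn_subpacketization.
  by rewrite -subnDA addnC subnDA leq_sub2r //= leq_sub2r.
have e : (delta k z N I * (#|I| - z) = N * k * (n - #|I|))%N.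
  by rewrite /delta divnK // -mulnA dvdn_mulr.
split=> //.
rewrite mulnDl -{2}(subnK lz) mulnDr e addnA -mulnDr.
by rewrite subnKC.
Qed.

(* Main.v *)
(* For a fixed secret the key determines the shares of any z nodes through
   invertible Vandermonde systems, so these shares are uniform whatever the secret
   is; this gives secrecy for every realization.  Decoding from a set I can fail
   only if the square system for I has a kernel vector y with nonzero secret part.
   As every column of the system carries uniform random entries against the secret
   part, a given y lies in the kernel with probability q^-D, where D is the size of
   the system.  There are at most q^D vectors y and a bad realization has at least
   q - 1 of them, so I is bad with probability at most 1 / (q - 1), and the union
   bound over the sets I gives 2^n / (q - 1). *)

Require Import Defs.
From HB Require Import structures.
From mathcomp Require Import all_boot all_order all_algebra.
From mathcomp Require Import boolp reals exp.
From mathcomp Require Import zify ring.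

Set Implicit Arguments.
Unset Strict Implicit.
Unset Printing Implicit Defensive.

Import Order.TTheory GRing.Theory Num.Theory.
Local Open Scope ring_scope.

(** * Conditional entropy at its two extremes *)

Section Entropy.
Variables (R : realType) (b : R) (Om : finType) (p : fdist R Om).

Lemma sum_law (A : finType) (X : Om -> A) : \sum_x law p X x = 1.
Proof. by rewrite -(pmf_sum1 p) (partition_big X xpredT). Qed.

Variables (A B : finType) (X : Om -> A) (Y : Om -> B).

Lemma logb1 : logb b 1 = 0.
Proof. by rewrite /logb ln1 mul0r. Qed.

(** Every term vanishes: on the graph of [g] the joint law equals the law of [Y], so the logarithm
    is that of 1, and off the graph the joint law is 0. Null outcomes are harmless, hence the
    restriction to [0 < p w]. *)
Lemma cond_entropy_fun (g : B -> A) :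
  (forall w, 0 < p w -> X w = g (Y w)) -> cond_entropy b p X Y = 0.
Proof.
move=> Xg; rewrite /cond_entropy big1 ?oppr0 // => y _; rewrite big1 // => x _.
have p0 w : X w != g (Y w) -> p w = 0.
  move=> /eqP Xw; apply/eqP; rewrite -[_ == _]negbK; apply/negP => pw.
  by apply/Xw/Xg; rewrite lt_def pw pmf_ge0.
have [-> {x}|xg] := eqVneq x (g y).
  have -> : law p (fun w => (X w, Y w)) (g y, y) = law p Y y.
    rewrite /law [RHS](bigID (fun w => X w == g y)) /= [X in _ + X]big1 ?addr0.
      by apply: eq_bigl => w; rewrite xpair_eqE andbC.
    by move=> w /andP[/eqP Yw Xw]; apply: p0; rewrite Yw.
  have [->|ly] := eqVneq (law p Y y) 0; first by rewrite mul0r.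
  by rewrite divff // logb1 mulr0.
rewrite /law big1 ?mul0r // => w; rewrite xpair_eqE => /andP[/eqP Xw /eqP Yw].
by apply: p0; rewrite Xw Yw.
Qed.

Lemma cond_entropy_indep :
  (forall x y, law p (fun w => (X w, Y w)) (x, y) = law p X x * law p Y y) ->
  cond_entropy b p X Y = entropy b p X.
Proof.
move=> ind; rewrite /cond_entropy /entropy; congr (- _).
rewrite exchange_big /=; apply: eq_bigr => x _.
transitivity (\sum_y law p Y y * (law p X x * logb b (law p X x))).
  apply: eq_bigr => y _; rewrite ind.
  (* For null [y] the quotient is by 0, but both sides carry the factor 0. *)
  have [->|ly] := eqVneq (law p Y y) 0; first by rewrite mulr0 !mul0r.
  by rewrite mulfK //; ring.
by rewrite -big_distrl /= sum_law mul1r.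
Qed.

End Entropy.

(** * One-time-pad secrecy and the union bound *)

Section Probability.
Variable R : realType.

(** By equal cardinalities each [f x] is a bijection, so exactly one key leads from [x] to a given
    [y]. The joint law is thus [p x / #|U|], a product, whatever [p] is. *)
Lemma cond_entropy_bijective_key (b : R) (T U V : finType) (p : fdist R T)
    (u0 : U) (f : T -> U -> V) :
  (forall x, injective (f x)) -> #|U| = #|V| ->
  cond_entropy b (indep p (uniform R u0)) fst (fun w => f w.1 w.2)
  = entropy b (indep p (uniform R u0)) fst.
Proof.
move=> f_inj cUV; apply: cond_entropy_indep.
have lawX x : law (indep p (uniform R u0)) fst x = p x.
  transitivity (\sum_(a | a == x) \sum_u p a * uniform R u0 u).
    by rewrite pair_big; apply: eq_bigl => w; rewrite andbT.
  by rewrite big_pred1_eq -big_distrr /= uniform_sum1 // mulr1.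
have lawXY x y : law (indep p (uniform R u0)) (fun w => (w.1, f w.1 w.2)) (x, y)
    = p x * #|U|%:R^-1.
  have [g fK gK] := inj_card_bij (f_inj x) (eq_leq (esym cUV)).
  rewrite /law (big_pred1 (x, g y)) // => -[a u] /=.
  rewrite !xpair_eqE; have [->|//] := eqVneq a x => /=.
  by rewrite (can2_eq fK gK).
move=> x y; rewrite lawXY lawX; congr (_ * _).
have -> : law (indep p (uniform R u0)) (fun w => f w.1 w.2) y =
    \sum_x law (indep p (uniform R u0)) (fun w => (w.1, f w.1 w.2)) (x, y).
  rewrite /law (partition_big fst xpredT) //=; apply: eq_bigr => a _.
  by apply: eq_bigl => w; rewrite xpair_eqE andbC.
by under eq_bigr do rewrite lawXY; rewrite -big_distrl /= pmf_sum1 mul1r.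
Qed.

Lemma le_Pr (T : finType) (p : fdist R T) (E E' : T -> Prop) :
  (forall x, E x -> E' x) -> Pr p E <= Pr p E'.
Proof.
move=> sub; rewrite /Pr [leRHS](bigID (fun x => `[< E x >])) /=.
rewrite [X in X + _](eq_bigl (fun x => `[< E x >])) => [|x].
  by rewrite lerDl sumr_ge0 // => x _; exact: pmf_ge0.
by rewrite andb_idl // => /asboolP/sub/asboolP.
Qed.

Lemma Pr_union_bound (T J : finType) (x0 : T) (bad : J -> pred T) (c : R) :
  (forall j, #|[set x | bad j x]|%:R <= c * #|T|%:R) ->
  1 - #|J|%:R * c <= Pr (uniform R x0) (fun x => forall j, ~~ bad j x).
Proof.
(* Multiplying by [#|T|] turns the claim into a count of good and bad points. *)
move=> badc; have T0 : 0 < #|T|%:R :> R by rewrite ltr0n; apply/card_gt0P; exists x0.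
rewrite -(ler_pM2r T0) /Pr /= sumr_const -[X in _ <= X * _]mulr_natl.
rewrite mulfVK ?gt_eqF //.
rewrite mulrBl mul1r lerBlDr.
set good := (fun x => _).
have cT : #|T| = (#|good| + #|[set x | [exists j, bad j x]]|)%N.
  rewrite -(cardC good); congr (_ + _)%N; rewrite cardsE; apply: eq_card => x.
  rewrite !inE /good unfold_in; apply/idP/existsP => [/asboolPn/existsNP|[j bj]].
    by move=> [j /negP]; rewrite negbK; exists j.
  by apply/asboolPn => /(_ j); rewrite bj.
rewrite {1}cT natrD lerD2l.
have -> : #|J|%:R * c * #|T|%:R = \sum_(j : J) c * #|T|%:R.
  by rewrite sumr_const -mulrA mulr_natl.
apply: le_trans (ler_sum _ (fun j _ => badc j)).
rewrite -natr_sum ler_nat -sum1_card big_mkcond /=.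
under [leqRHS]eq_bigr do rewrite -sum1_card big_mkcond /=.
(* Counted point by point, a bad [x] contributes 1 on the left and at least 1, from its witness [j],
   on the right. *)
rewrite exchange_big leq_sum //= => x _; rewrite inE.
case: existsP => // -[j bj]; rewrite (bigD1 j) //= inE bj; exact: leq_addr.
Qed.

End Probability.

(** * Coordinates of row vectors and Vandermonde systems *)

Section Coordinates.
Variable F : finFieldType.

(** Indexing by [nat] with default 0 lets vectors of different lengths be compared without casts
    between ordinal types. *)
Definition entry (l : nat) (x : 'rV[F]_l) (a : nat) : F :=
  if insub a is Some b then x 0 (b : 'I_l) else 0.

Lemma entryE l (x : 'rV[F]_l) (a : 'I_l) : entry x a = x 0 a.
Proof. by rewrite /entry valK. Qed.

Lemma entry_eqP l (x y : 'rV[F]_l) :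
  (forall a, (a < l)%N -> entry x a = entry y a) -> x = y.
Proof. by move=> xy; apply/rowP => a; rewrite -!entryE xy. Qed.

Lemma entry_resize l p (x : 'rV[F]_l) a :
  entry (resize p x) a = if (a < p)%N then entry x a else 0.
Proof.
rewrite {1}/entry; case: insubP => [b ltb eb|]; first by rewrite mxE eb ltb.
by move/negPf->.
Qed.

Lemma entry_out l (x : 'rV[F]_l) a : (l <= a)%N -> entry x a = 0.
Proof. by move=> la; rewrite /entry insubF // ltnNge la. Qed.

Lemma entry_row_mxl l l' (x : 'rV[F]_l) (y : 'rV[F]_l') a : (a < l)%N ->
  entry (row_mx x y) a = entry x a.
Proof.
move=> la; rewrite -[a]/(val (Ordinal la)) entryE -(row_mxEl x y).
by rewrite -[RHS]entryE.
Qed.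

Lemma entry_lsubmx l l' (x : 'rV[F]_(l + l')) a : (a < l)%N ->
  entry (lsubmx x) a = entry x a.
Proof. by move=> la; rewrite -{2}(hsubmxK x) entry_row_mxl. Qed.

Lemma entry0 l a : entry (0 : 'rV[F]_l) a = 0.
Proof. by rewrite /entry; case: insub => // b; rewrite mxE. Qed.

Lemma resize_is_linear l p : linear (@resize F l p).
Proof.
move=> c x y; apply/rowP => a; rewrite !mxE.
by case: insub => [b|]; rewrite ?mxE // mulr0 addr0.
Qed.

HB.instance Definition _ l p :=
  GRing.isLinear.Build F 'rV[F]_l 'rV[F]_p _ (@resize F l p)
    (@resize_is_linear l p).

(** A nonzero polynomial with [m] coefficients has fewer than [m] roots. This replaces the
    invertibility of a Vandermonde matrix. *)
Lemma coefs_eq0 (T : finType) (A : {set T}) (f : T -> F) m (c : nat -> F) :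
  {in A &, injective f} -> (m <= #|A|)%N ->
  {in A, forall t, \sum_(u < m) c u * f t ^+ u = 0} ->
  forall u, (u < m)%N -> c u = 0.
Proof.
move=> f_inj mA c0 u um; pose p := \poly_(u < m) c u.
have p0 : p = 0.
  apply/eqP/negPn/negP => pn0.
  have /(max_poly_roots pn0) : all (root p) [seq f t | t <- enum A].
    apply/allP => _ /mapP[t + ->]; rewrite mem_enum => tA.
    by rewrite /root horner_poly c0.
  rewrite map_inj_in_uniq ?enum_uniq => [|t t']; last first.
    by rewrite !mem_enum; exact: f_inj.
  by move=> /(_ isT); rewrite size_map -cardE ltnNge (leq_trans (size_poly _ _) mA).
by have := coef_poly m c u; rewrite um -/p p0 coef0.
Qed.

End Coordinates.

Lemma card_ord_lt n m : (m <= n)%N -> #|[set i : 'I_n | (i < m)%N]| = m.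
Proof.
move=> mn; rewrite -sum1_card; under eq_bigl do rewrite inE.
by rewrite -(big_ord_widen _ (fun _ => 1%N) mn) sum1_card card_ord.
Qed.

(** * Secrecy for every realization *)

Section Security.
Variables (n k r z N : nat) (F : finFieldType).
Variable alpha : 'I_n -> 'I_(share_len k r N) -> F.

Local Notation L := (share_len k r N).
Local Notation len := (input_len k r z N).
Local Notation M := (k * L)%N.

(** The first [N * k + e] symbols of a share involve only the first [e] blocks of length [z] of k'.
    Every truncation below rests on this. *)
Lemma rows_le (e : nat) (i : 'I_L) : (i < N * k + e)%N ->
  (R_rows z i + V_rows z i <= M + N * k * z + e * z)%N.
Proof.
rewrite /R_rows /V_rows; case: (ltnP i (N * k)%N) => ik ie.
  exact: leq_addr.
by rewrite -addnA leq_add2l -mulSnr leq_mul2r ltn_subLR // ie orbT.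
Qed.

Lemma rows_le_len (i : 'I_L) : (R_rows z i + V_rows z i <= len)%N.
Proof. by apply: rows_le; rewrite -mulnDr. Qed.

Lemma msg_le_rows (i : 'I_L) : (M <= R_rows z i)%N.
Proof. by rewrite /R_rows; case: ifP; rewrite // -addnA leq_addr. Qed.

Implicit Types (Rs : realization n k r z N F) (x : 'rV[F]_len).

(** The sum over [G] splits at the block boundaries into the random block and the Vandermonde block;
    the zero block drops out. *)
Lemma shareE Rs x j i :
  share alpha Rs x j 0 i =
    \sum_(u < R_rows z i) entry x u * Rs i u j
  + \sum_(u < V_rows z i) entry x (R_rows z i + u) * alpha j i ^+ u.
Proof.
pose g u := entry x u * (if insub u is Some u' then Rs i (u' : 'I_(R_rows z i)) j
  else if (u < R_rows z i + V_rows z i)%N then alpha j i ^+ (u - R_rows z i)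
  else 0).
have -> : share alpha Rs x j 0 i = \sum_(0 <= u < len) g u.
  by rewrite big_mkord !mxE; apply: eq_bigr => u _; rewrite mxE /g entryE.
rewrite (big_cat_nat (n := R_rows z i)) //=; last first.
  by apply: leq_trans (rows_le_len i); exact: leq_addr.
congr (_ + _).
  by rewrite big_mkord; apply: eq_bigr => u _; rewrite /g valK.
rewrite (big_cat_nat (n := (R_rows z i + V_rows z i)%N)) ?leq_addr ?rows_le_len //=.
rewrite [X in _ + X]big_nat_cond [X in _ + X]big1 ?addr0; last first.
  move=> u /andP[/andP[lu _] _]; rewrite /g insubF; last first.
    by rewrite ltnNge (leq_trans (leq_addr _ _) lu).
  by rewrite ltnNge lu mulr0.
rewrite -{1}[R_rows z i]add0n big_addn addKn big_mkord; apply: eq_bigr => u _.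
rewrite /g insubF; last by rewrite ltnNge leq_addl.
by rewrite addnK addnC ltn_add2l ltn_ord.
Qed.

Lemma shareZD Rs c x x' j :
  share alpha Rs (c *: x + x') j = c *: share alpha Rs x j + share alpha Rs x' j.
Proof. by apply/rowP => i; rewrite mxE mulmxDl -scalemxAl !mxE. Qed.

Lemma shareB Rs x x' j :
  share alpha Rs (x - x') j = share alpha Rs x j - share alpha Rs x' j.
Proof. by rewrite addrC -scaleN1r shareZD scaleN1r addrC. Qed.

Lemma share_trunc Rs x x' j (i : 'I_L) e :
  (forall u, (u < M + N * k * z + e * z)%N -> entry x u = entry x' u) ->
  (i < N * k + e)%N -> share alpha Rs x j 0 i = share alpha Rs x' j 0 i.
Proof.
move=> xx' /rows_le le; rewrite !shareE; congr (_ + _); apply: eq_bigr => u _.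
  by rewrite xx' // (leq_trans _ le) // (leq_trans (ltn_ord u)) ?leq_addr.
by rewrite xx' // (leq_trans _ le) // ltn_add2l.
Qed.

(* Read off the columns [i < N * k] first and then [i = N * k, N * k + 1, ...]:
   each time the new coordinates of [x] are the coefficients of a polynomial that
   vanishes at as many distinct points as it has coefficients. *)
Lemma share_eq0 Rs x (I : {set 'I_n}) :
  injective (fun vi : 'I_n * 'I_L => alpha vi.1 vi.2) -> (z <= #|I|)%N ->
  (forall u, (u < M)%N -> entry x u = 0) ->
  {in I, forall v, share alpha Rs x v = 0} -> x = 0.
Proof.
move=> alpha_inj zI xM shx.
have Vsum (i : 'I_L) v : v \in I ->
    (forall u, (u < R_rows z i)%N -> entry x u = 0) ->
    \sum_(u < V_rows z i) entry x (R_rows z i + u) * alpha v i ^+ u = 0.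
  move=> vI x0; have := shx v vI => /rowP/(_ i); rewrite shareE mxE big1 ?add0r //.
  by move=> u _; rewrite x0 // mul0r.
have NkL : (N * k <= L)%N by rewrite leq_mul2l leq_addr orbT.
have x1 u : (u < M + N * k * z)%N -> entry x u = 0.
  have [uM _|Mu] := ltnP u M; first exact: xM.
  rewrite -{1}(subnKC Mu) ltn_add2l -{2}(subnKC Mu); move: (u - M)%N => {Mu}u.
  (* The first [N * k] matrices share the same Vandermonde unknowns k, so their evaluation points
     are pooled: at least [N * k * z] points for [N * k * z] coefficients. *)
  pose A := setX I [set i : 'I_L | (i < N * k)%N].
  apply: (@coefs_eq0 _ _ A (fun vi => alpha vi.1 vi.2) _ (fun u => entry x (M + u))).
  - by move=> ? ? _ _; apply: alpha_inj.
  - by rewrite cardsX card_ord_lt // mulnC leq_mul2r zI orbT.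
  move=> [v i]; rewrite !inE /= => /andP[vI ik].
  by have := Vsum i v vI; rewrite /R_rows /V_rows ik => /(_ xM).
(* Each further symbol brings one new block of [z] unknowns of k', and the nodes of [I] supply at
   least [z] points for it. *)
have x2 e : (e <= N * r)%N ->
    forall u, (u < M + N * k * z + e * z)%N -> entry x u = 0.
  elim: e => [_ u|e IHe er u]; first by rewrite mul0n addn0; exact: x1.
  have {}IHe := IHe (ltnW er).
  have [ub _|bu] := ltnP u (M + N * k * z + e * z); first exact: IHe.
  rewrite -{1}(subnKC bu) mulSnr addnA ltn_add2l -{2}(subnKC bu).
  move: (u - _)%N => {bu}u.
  have iL : (N * k + e < L)%N by rewrite /share_len mulnDr ltn_add2l.
  pose i := Ordinal iL.
  have Ri : R_rows z i = (M + N * k * z + e * z)%N.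
    by rewrite /R_rows /= ltnNge leq_addr addKn.
  have Vi : V_rows z i = z by rewrite /V_rows /= ltnNge leq_addr.
  apply: (@coefs_eq0 _ _ I (alpha^~ i) _ (fun u => entry x (_ + u))) => //.
  - by move=> v w _ _ e'; case: (alpha_inj (v, i) (w, i) e').
  by move=> v vI; have := Vsum i v vI; rewrite Ri Vi => /(_ IHe).
apply: entry_eqP => a al; rewrite entry0; exact: (x2 _ (leqnn _)).
Qed.

(** For a fixed secret, two keys with the same shares on [I] differ by an input with zero secret
    part and zero shares on [I], so [share_eq0] makes the key-to-shares map injective. *)
Lemma scheme_secure (R : realType) Rs :
  injective (fun vi : 'I_n * 'I_L => alpha vi.1 vi.2) ->
  secure z (scheme R alpha Rs).
Proof.
move=> alpha_inj p I Iz.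
refine (@cond_entropy_bijective_key R _ _ (scheme_key k r z N F) _ p (0, 0)
  (fun m w => restrict I (@enc _ _ _ _ (scheme R alpha Rs) m w)) _ _).
  move=> m [w1 w2] [w1' w2'] /ffunP eqs.
  set x := row_mx (row_mx (flatten_secret m) w1) w2.
  set x' := row_mx (row_mx (flatten_secret m) w1') w2'.
  have d0 : x - x' = 0.
    apply: (share_eq0 (Rs := Rs) (I := I)) => //; first by rewrite Iz.
      move=> u uM; rewrite /x /x' opp_row_mx add_row_mx opp_row_mx add_row_mx.
      rewrite subrr entry_row_mxl ?entry_row_mxl ?entry0 //.
      exact: leq_trans (leq_addr _ _).
    move=> v vI; rewrite shareB; apply/eqP; rewrite subr_eq0.
    by have := eqs (exist _ v vI); rewrite !ffunE /= => ->.
  move/eqP: d0; rewrite subr_eq0 => /eqP /eq_row_mx[/eq_row_mx[_ ->] ->] //.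
rewrite card_prod !card_mx !mul1n card_ffun card_mx mul1n card_sig -expnD -expnM.
(* Keys and share tuples both number [#|F|] to the power [N * (k + r) * z]. *)
congr (_ ^ _)%N; rewrite -[#|_|]/#|I| Iz /share_len; ring.
Qed.

End Security.

(** * Decoding and the count of realizations where it fails *)

Lemma decodes_reliable (R : realType) (n k r : nat) (Q : finType)
    (S : encoding R n k Q) (D : decoding n k Q) :
  (forall I : {set 'I_n}, #|I| = (n - r)%N -> decodes S D I) -> reliable r S.
Proof.
move=> dec p I /dec[_ decI].
pose g (c : {ffun {i : 'I_n | i \in I} -> Q}) :=
  decode (fun i : {i : 'I_n | i \in I} => preprocess D I (val i) (c i)).
apply: (cond_entropy_fun _ (g := g)) => -[m w] /= pw.
have w0 : 0 < key_dist S w.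
  by rewrite lt_def pmf_ge0 andbT; apply: contraTneq pw => ->; rewrite mulr0 ltxx.
rewrite -[LHS](decI m w w0); congr decode.
by apply: functional_extensionality_dep => i; rewrite ffunE.
Qed.

Section Decoding.
Variables (n k r z N : nat) (F : finFieldType).
Variable alpha : 'I_n -> 'I_(share_len k r N) -> F.

Local Notation L := (share_len k r N).
Local Notation len := (input_len k r z N).
Local Notation M := (k * L)%N.
Implicit Types (Rs : realization n k r z N F) (x : 'rV[F]_len) (I : {set 'I_n}).

Lemma flatten_secretK : cancel (@flatten_secret k r N F) (@unflatten_secret k r N F).
Proof.
move=> m; apply/ffunP => t; rewrite ffunE /flatten_secret mxvecK.
by apply/rowP => a; rewrite !mxE.
Qed.

(* Every [R_i] has a row [u0]; changing that row at the positions in [P] gives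
   [#|F| ^ #|P|] disjoint translates of the set of realizations counted here. *)
Lemma card_share_eq0 x (u0 : nat) (P : {set 'I_L * 'I_n}) :
  (u0 < M)%N -> entry x u0 != 0 ->
  (#|[set Rs | [forall p in P, share alpha Rs x p.2 0%R p.1 == 0%R]]|
     * #|F| ^ #|P| <= #|{: realization n k r z N F}|)%N.
Proof.
move=> u0M x0; set Z := [set Rs | _].
(* [T] prescribes by how much the share symbols at positions in [P] move. Dividing by entry [u0] of
   [x] in [shift] makes the displacement exactly [T]. *)
pose val_at (T : {ffun {p | p \in P} -> F}) p := oapp T 0 (insub p).
pose shift (RT : realization n k r z N F * {ffun {p | p \in P} -> F}) :
    realization n k r z N F := finfun (fun i => RT.1 i +
      \matrix_(u, v) (if u == u0 :> nat then val_at RT.2 (i, v) / entry x u0 else 0)).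
have share_shift Rs T v i :
    share alpha (shift (Rs, T)) x v 0 i = share alpha Rs x v 0 i + val_at T (i, v).
  rewrite !shareE addrAC; congr (_ + _).
  under eq_bigr do rewrite ffunE !mxE mulrDr.
  rewrite big_split /=; congr (_ + _).
  rewrite (bigD1 (Ordinal (leq_trans u0M (msg_le_rows z i)))) //= eqxx mulrC divfK //.
  rewrite big1 ?addr0 // => u; rewrite -val_eqE /= => /negPf->; exact: mulr0.
have -> : (#|F| ^ #|P| = #|[set: {ffun {p | p \in P} -> F}]|)%N.
  by rewrite cardsT card_ffun card_sig.
rewrite -cardsX -(card_in_imset (f := shift)); first exact: max_card.
move=> [Rs T] [Rs' T']; rewrite !inE /= !andbT => /forall_inP Z1 /forall_inP Z2 e.
(* Both original shares vanish on [P], so the shifted shares reveal [T]. *)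
have eT : T = T'.
  apply/ffunP => -[[i v] iP].
  have := congr1 (fun Rs => share alpha Rs x v 0 i) e.
  rewrite !share_shift (eqP (Z1 _ iP)) (eqP (Z2 _ iP)) !add0r /val_at.
  by rewrite insubT.
congr (_, _) => //; apply/ffunP => i.
by have := congr1 (fun Rs => (Rs : realization _ _ _ _ _ _) i) e; rewrite !ffunE eT => /addIr.
Qed.

(** The number of unknowns of the decoding system for [I]. *)
Definition truncated_len I := (M + N * k * z + delta k z N I * z)%N.

Definition vanishes Rs I (y : 'rV[F]_(truncated_len I)) : bool :=
  [forall v in I, resize (N * k + delta k z N I) (share alpha Rs (resize len y) v) == 0].

(* The decoding equations are linear, so if no [y] as below exists then all their
   solutions have the same secret part. *)
Definition ambiguous I Rs : bool :=
  [exists y : 'rV[F]_(truncated_len I), (lsubmx (lsubmx y) != 0) && vanishes Rs y].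

(** The discarded entries of k' have zero coefficients in the symbols that are kept. *)
Lemma resize_share Rs I x (v : 'I_n) : (delta k z N I <= N * r)%N ->
  resize (N * k + delta k z N I) (share alpha Rs (resize len (resize (truncated_len I) x)) v)
  = resize (N * k + delta k z N I) (share alpha Rs x v).
Proof.
move=> dr; have eL : (N * k + delta k z N I <= L)%N by rewrite /share_len mulnDr leq_add2l.
apply: entry_eqP => a ae; rewrite !entry_resize ae.
rewrite -[a]/(val (Ordinal (leq_trans ae eL))) !entryE.
apply: (share_trunc alpha Rs v (e := delta k z N I)) => // u ul.
rewrite !entry_resize ul; case: ltnP => // lu.
by rewrite entry_out.
Qed.

(* Double counting of the pairs of a realization and a kernel vector [y] with
   nonzero secret part: each [y] is in the kernel for at most a fraction
   [#|F| ^ - truncated_len I] of the realizations, and each ambiguous realization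
   has all nonzero multiples of some [y] in its kernel. *)
Lemma card_ambiguous I : (delta k z N I <= N * r)%N ->
  truncated_len I = ((N * k + delta k z N I) * #|I|)%N ->
  (#|[set Rs | ambiguous I Rs]| * #|F|.-1 <= #|{: realization n k r z N F}|)%N.
Proof.
move=> dr Dl; set e := (N * k + delta k z N I)%N in Dl.
pose msg (y : 'rV[F]_(truncated_len I)) := lsubmx (lsubmx y).
have eL : (e <= L)%N by rewrite /share_len mulnDr leq_add2l.
have card_vanishes y : msg y != 0 ->
    (#|[set Rs | vanishes Rs y]| * #|F| ^ truncated_len I
      <= #|{: realization n k r z N F}|)%N.
  case/rV0Pn => u; rewrite -entryE !entry_lsubmx; last first.
  - exact: leq_trans (ltn_ord u) _.
  - by rewrite (leq_trans (ltn_ord u)) // leq_addr.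
  (* One position per decoding equation. The system being square, [#|P|] is also the number of
     unknowns. *)
  move=> yu; pose P := setX [set i : 'I_L | (i < e)%N] I.
  have cP : #|P| = truncated_len I by rewrite cardsX card_ord_lt.
  rewrite -cP; apply: leq_trans (card_share_eq0 (x := resize len y) (u0 := u) P _ _) => //.
    rewrite leq_mul2r; apply/orP; right; apply: subset_leq_card; apply/subsetP => Rs.
    rewrite !inE => /forall_inP sh; apply/forall_inP => -[i v]; rewrite !inE /=.
    move=> /andP[ie vI]; have /eqP := sh v vI.
    move/(congr1 (fun s => entry s i)); rewrite entry_resize ie entryE => ->.
    by rewrite entry0.
  rewrite entry_resize ifT // (leq_trans (ltn_ord u)) // /input_len -addnA.
  exact: leq_addr.
have many Rs : ambiguous I Rs ->
    (#|F|.-1 <= #|[set y : 'rV[F]_(truncated_len I) | (msg y != 0%R) && vanishes Rs y]|)%N.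
  case/existsP => y /andP[y0 yV].
  have yn0 : y != 0 by apply: contraNneq y0 => ->; rewrite !linear0.
  rewrite -(cardC1 (0 : F)) -(card_in_imset (f := fun c => c *: y)); last first.
    move=> c c' _ _ /eqP.
    by rewrite -subr_eq0 -scalerBl scaler_eq0 (negPf yn0)
      orbF subr_eq0 => /eqP.
  apply: subset_leq_card; apply/subsetP => _ /imsetP[c c0 ->]; rewrite inE /msg !linearZ /=.
  rewrite scaler_eq0 negb_or (c0 : c != 0) y0 /=; apply/forall_inP => v vI.
  have := shareZD alpha Rs c (resize len y) 0 v.
  rewrite addr0 linearZ => ->; rewrite linearD linearZ /=.
  have := forall_inP yV v vI => /eqP->.
  have -> : share alpha Rs 0 v = 0 by apply/rowP => i; rewrite mxE mul0mx !mxE.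
  by rewrite scaler0 add0r linear0.
have q0 : (0 < #|F| ^ truncated_len I)%N.
  by rewrite expn_gt0; apply/orP; left; apply/card_gt0P; exists 0.
(* This factor cancels at the end against the number of vectors [y]. *)
rewrite -(leq_pmul2r q0).
apply: (@leq_trans (\sum_(y | msg y != 0%R) #|[set Rs | vanishes Rs y]| * #|F| ^ truncated_len I)).
  rewrite -big_distrl leq_mul2r /=; apply/orP; right.
  apply: (@leq_trans (\sum_(Rs in [set Rs | ambiguous I Rs])
      #|[set y : 'rV[F]_(truncated_len I) | (msg y != 0%R) && vanishes Rs y]|)).
    by rewrite -sum_nat_const leq_sum // => Rs; rewrite inE; exact: many.
  under eq_bigr do rewrite -sum1_card big_mkcond /=.
  under [leqRHS]eq_bigr do rewrite -sum1_card big_mkcond /=.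
  rewrite exchange_big [leqRHS]big_mkcond leq_sum //= => y _.
  rewrite big_mkcond /=; case: ifP => y0; last first.
    by rewrite big1 // => Rs _; rewrite !inE y0; case: ifP.
  by rewrite leq_sum // => Rs _; rewrite !inE y0 /=; case: ambiguous.
apply: (@leq_trans (\sum_(y | msg y != 0%R) #|{: realization n k r z N F}|)).
  by apply: leq_sum => y; exact: card_vanishes.
rewrite sum_nat_const mulnC leq_mul2l; apply/orP; right.
by rewrite (leq_trans (max_card _)) // card_mx mul1n.
Qed.

(** The true input, truncated, solves the system, so [pick] succeeds. Its choice differs from the
    true solution by a kernel vector, whose secret part must be 0. *)
Lemma decodes_scheme (R : realType) Rs I : (delta k z N I <= N * r)%N ->
  ~~ ambiguous I Rs -> decodes (scheme R alpha Rs) (scheme_decoding alpha Rs) I.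
Proof.
move=> dr namb; split=> [i _|m w _].
  rewrite !card_mx !mul1n leq_pexp2l //; first by apply/card_gt0P; exists 0.
  by rewrite /share_len mulnDr leq_add2l.
rewrite [LHS]/=; set s := (fun i : {i | i \in I} => _).
pose x := row_mx (row_mx (flatten_secret m) w.1) w.2.
have sE i : s i = resize (N * k + delta k z N I) (share alpha Rs x (val i)).
  by rewrite /s ffunE.
have sol : solves alpha Rs s (resize (truncated_len I) x).
  by apply/forallP => i; rewrite sE resize_share.
case: pickP => [y ysol|/(_ (resize (truncated_len I) x))]; last by rewrite sol.
rewrite /= -[RHS]flatten_secretK; congr unflatten_secret.
transitivity (lsubmx (lsubmx (resize (truncated_len I) x))); last first.
  apply: entry_eqP => a aM; have aM' : (a < M + N * k * z)%N by rewrite ltn_addr.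
  by rewrite !entry_lsubmx // entry_resize ltn_addr // !entry_row_mxl.
apply/eqP; rewrite -subr_eq0 -!linearB; apply: contraNT namb => y0.
apply/existsP; exists (y - resize (truncated_len I) x); rewrite y0 /=.
apply/forall_inP => v vI; rewrite linearB shareB linearB /= subr_eq0.
have /eqP <- := forallP ysol (exist _ v vI).
by have /eqP <- := forallP sol (exist _ v vI).
Qed.

End Decoding.

Lemma subpacketization_gt0 n r z : (0 < n - z - r)%N -> (0 < subpacketization n r z)%N.
Proof.
move=> k0; rewrite /subpacketization big_nat_cond.
apply: (big_ind (fun m => 0 < m)%N) => [//|a b a0 b0|i /andP[/andP[li _] _]].
  by rewrite lcmn_gt0 a0.
exact: leq_trans li.
Qed.

(** * Arithmetic of [delta] and the decoding bandwidth *)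

Section AvailableNodes.
Variables (n r z k N : nat).
Hypotheses (k_def : k = (n - r - z)%N) (k_gt0 : (1 <= k)%N).
Hypothesis N_def : N = subpacketization n r z.
Variable I : {set 'I_n}.
Hypothesis rI : (n - r <= #|I|)%N.

Lemma N_gt0 : (0 < N)%N.
Proof. by rewrite N_def subpacketization_gt0 // subnAC -k_def. Qed.

Lemma z_ltI : (z < #|I|)%N.
Proof. by apply: leq_trans rI; rewrite -subn_gt0 -k_def. Qed.

Lemma n_split : n = (k + r + z)%N.
Proof. lia. Qed.

Lemma cardI_le : (#|I| <= n)%N.
Proof. by rewrite -[X in (_ <= X)%N]card_ord max_card. Qed.

Lemma deltaE : (delta k z N I * (#|I| - z) = N * k * (n - #|I|))%N.
Proof. by have := @delta_exact n r z I; rewrite /= -k_def -N_def => /(_ k_gt0 rI)[]. Qed.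

Lemma delta_le : (delta k z N I <= N * r)%N.
Proof.
rewrite -(leq_pmul2r (m := #|I| - z)) ?subn_gt0 ?z_ltI // deltaE.
rewrite -!mulnA leq_mul2l; apply/orP; right.
have := cardI_le; have := n_split; have := z_ltI; have := rI.
move: #|I| => d rd zd nE dn.
have [a ad] : exists a, d = (k + z + a)%N by exists (d - (k + z))%N; lia.
subst d; have -> : (k + z + a - z = k + a)%N by lia.
nia.
Qed.

Lemma unknowns_eq_equations :
  truncated_len k r z N I = ((N * k + delta k z N I) * #|I|)%N.
Proof.
have := @delta_exact n r z I; rewrite /= -k_def -N_def => /(_ k_gt0 rI)[_ ->].
have -> : (N * k * n = N * k * (k + r + z))%N by rewrite -n_split.
by rewrite /truncated_len /share_len; ring.
Qed.

Lemma piece_lenE : ((N * k + delta k z N I) * (#|I| - z) = N * k * (k + r))%N.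
Proof.
by rewrite mulnDl deltaE -mulnDr; congr (_ * _)%N; have := n_split; have := z_ltI;
  have := cardI_le; lia.
Qed.

(** By [piece_lenE] each piece is a fraction [k / (#|I| - z)] of a share. The [#|I|] pieces total
    [k * #|I| / (#|I| - z)], which exceeds [k] by the claimed overhead. *)
Lemma optimal_bandwidth_scheme (R : realType) (F : finFieldType)
    (alpha : 'I_n -> 'I_(share_len k r N) -> F) (Rs : realization n k r z N F) :
  comm_overhead R (scheme_decoding alpha Rs) I = (k * z)%:R / (#|I|%:R - z%:R).
Proof.
rewrite /comm_overhead /= sumr_const /logb !card_mx !mul1n !natrX.
have q1 : 1 < #|F|%:R :> R.
  by rewrite ltr1n; apply/card_gt1P; exists 0, 1; rewrite !inE eq_sym oner_eq0.
have lnq : ln (#|F|%:R : R) != 0.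
  by apply: lt0r_neq0; exact: ln_gt0.
have q0 : 0 < #|F|%:R :> R by apply: lt_trans q1.
rewrite !(lnXn _ q0).
rewrite -[X in X - _]mulr_natr -[ln _ *+ (_ + _)]mulr_natr -[ln _ *+ share_len _ _ _]mulr_natr.
have eI : (#|I| - z)%:R = #|I|%:R - z%:R :> R by rewrite natrB // ltnW // z_ltI.
have Iz : #|I|%:R - z%:R != 0 :> R by rewrite -eI pnatr_eq0 subn_eq0 -ltnNge z_ltI.
have L0 : (share_len k r N)%:R != 0 :> R.
  by rewrite pnatr_eq0 -lt0n muln_gt0 N_gt0 addn_gt0 k_gt0.
have /(congr1 (fun a => a%:R : R)) := piece_lenE.
rewrite natrM eI => pE.
have -> : (N * k + delta k z N I)%:R = k%:R * (share_len k r N)%:R / (#|I|%:R - z%:R) :> R.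
  by apply: (mulIf Iz); rewrite pE divfK // -natrM /share_len; congr _%:R; ring.
rewrite natrM; field.
by rewrite lnq L0 Iz.
Qed.

End AvailableNodes.

(** * Simultaneous decodability for all available sets *)

Section UnambiguousRealizations.
Variables (R : realType) (n r z k N : nat) (F : finFieldType).
Variable alpha : 'I_n -> 'I_(share_len k r N) -> F.
Hypotheses (k_def : k = (n - r - z)%N) (k_gt0 : (1 <= k)%N).
Hypothesis N_def : N = subpacketization n r z.

(** Asking for all available [I] at once gives a single event that serves both reliability and
    decoding for every [d]. *)
Lemma Pr_unambiguous :
  1 - (2 ^ n)%:R / (#|F|%:R - 1) <=
    Pr (realization_dist R n k r z N F)
       (fun Rs => forall I : {set 'I_n}, (n - r <= #|I|)%N -> ~~ ambiguous alpha I Rs).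
Proof.
have q1 : 0 < #|F|%:R - 1 :> R.
  rewrite subr_gt0 ltr1n; apply/card_gt1P.
  by exists 0, 1; split=> //; rewrite eq_sym oner_eq0.
have <- : #|{set 'I_n}| = (2 ^ n)%N by rewrite -cardsT -powersetT card_powerset cardsT card_ord.
pose bad (I : {set 'I_n}) (Rs : realization n k r z N F) :=
  (n - r <= #|I|)%N && ambiguous alpha I Rs.
apply: (le_trans (Pr_union_bound (realization0 n k r z N F) (bad := bad) _)) => [I|].
  (* The union bound is applied with [c] equal to [1 / (q - 1)], over all [2 ^ n] subsets; sets that
     are too small are never bad. *)
  rewrite -(ler_pM2r q1) mulrAC mulVf ?gt_eqF // mul1r.
  have [rI|nrI] := leqP (n - r) #|I|; last first.
    rewrite (eq_card0 (A := [set Rs | _])) ?mul0r // => Rs.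
    by rewrite !inE /bad leqNgt nrI.
  have := card_ambiguous alpha (delta_le k_def k_gt0 N_def rI)
    (unknowns_eq_equations k_def k_gt0 N_def rI).
  rewrite -(ler_nat R) natrM -subn1 natrB; last by apply/card_gt0P; exists 0.
  apply: le_trans; rewrite ler_pM2r // ler_nat subset_leq_card //.
  by apply/subsetP => Rs; rewrite !inE => /andP[].
by apply: le_Pr => Rs good I rI; have := good I; rewrite /bad rI.
Qed.

Lemma unambiguous_decodes (Rs : realization n k r z N F) :
  (forall I : {set 'I_n}, (n - r <= #|I|)%N -> ~~ ambiguous alpha I Rs) ->
  forall I : {set 'I_n}, (n - r <= #|I|)%N ->
    decodes (scheme R alpha Rs) (scheme_decoding alpha Rs) I.
Proof.
move=> good I rI; apply: decodes_scheme; last exact: good.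
exact: delta_le rI.
Qed.

Lemma unambiguous_reliable (Rs : realization n k r z N F) :
  (forall I : {set 'I_n}, (n - r <= #|I|)%N -> ~~ ambiguous alpha I Rs) ->
  reliable r (scheme R alpha Rs).
Proof.
move=> good; apply: (decodes_reliable (D := scheme_decoding alpha Rs)) => I cI.
by apply: unambiguous_decodes good _ _; rewrite cI.
Qed.

End UnambiguousRealizations.

Theorem corollary1 (R : realType) (n r z k N : nat)
    (n_ge1 : (1 <= n)%N)
    (k_def : k = (n - r - z)%N)
    (k_ge1 : (1 <= k)%N)
    (N_def : N = subpacketization n r z) :
  (forall (F : finFieldType) (alpha : 'I_n -> 'I_(share_len k r N) -> F),
    (n * (N * (k + r)) <= #|[set x : F | x != 0%R]|)%N ->
    (forall v i, alpha v i != 0) ->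
    injective (fun vi : 'I_n * 'I_(share_len k r N) => alpha vi.1 vi.2) ->
    [/\ forall Rs : realization n k r z N F, secure z (scheme R alpha Rs),
        1 - (2 ^ n)%:R / (#|F|%:R - 1) <=
          Pr (realization_dist R n k r z N F)
             (fun Rs => reliable r (scheme R alpha Rs)),
        forall (Rs : realization n k r z N F) (d : nat),
          (n - r <= d)%N -> (d <= n)%N ->
          optimal_bandwidth R z (scheme_decoding alpha Rs) d
      & 1 - (2 ^ n)%:R / (#|F|%:R - 1) <=
          Pr (realization_dist R n k r z N F)
             (fun Rs =>
                rate_optimal_secret_sharing r z (scheme R alpha Rs) /\
                forall d : nat, (n - r <= d)%N -> (d <= n)%N ->
                  (forall I : {set 'I_n}, #|I| = d ->
                     decodes (scheme R alpha Rs) (scheme_decoding alpha Rs) I) /\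
                  optimal_bandwidth R z (scheme_decoding alpha Rs) d)]) /\
  (forall eps : R, 0 < eps -> exists q0 : nat,
     forall (F : finFieldType) (alpha : 'I_n -> 'I_(share_len k r N) -> F),
       (n * (N * (k + r)) <= #|[set x : F | x != 0%R]|)%N ->
       (forall v i, alpha v i != 0) ->
       injective (fun vi : 'I_n * 'I_(share_len k r N) => alpha vi.1 vi.2) ->
       (q0 <= #|F|)%N ->
       1 - eps <=
         Pr (realization_dist R n k r z N F)
            (fun Rs => rate_optimal_secret_sharing r z (scheme R alpha Rs))).
Proof.
split=> [F alpha _ _ alpha_inj|eps eps0].
  have bandwidth (Rs : realization n k r z N F) d : (n - r <= d)%N -> (d <= n)%N ->
      optimal_bandwidth R z (scheme_decoding alpha Rs) d.
    move=> rd _ I Id; apply: (optimal_bandwidth_scheme k_def k_ge1 N_def).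
    by rewrite Id.
  split=> [Rs||//|]; first exact: scheme_secure.
    apply: le_trans (Pr_unambiguous R alpha k_def k_ge1 N_def) (le_Pr _ _) => Rs.
    exact: unambiguous_reliable.
  apply: le_trans (Pr_unambiguous R alpha k_def k_ge1 N_def) (le_Pr _ _) => Rs good.
  split; first by do !split=> //; [exact: unambiguous_reliable|exact: scheme_secure].
  move=> d rd dn; split; last exact: bandwidth.
  by move=> I Id; apply: unambiguous_decodes good _ _; rewrite ?Id.
(* The successor absorbs the 1 in [q - 1]: then [2 ^ n / eps < q - 1], so the failure bound is at
   most [eps]. *)
exists (Num.bound ((2 ^ n)%:R / eps)).+1 => F alpha _ _ alpha_inj q0F.
apply: le_trans (le_trans (Pr_unambiguous R alpha k_def k_ge1 N_def) (le_Pr _ _)).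
  have q_gt : (2 ^ n)%:R / eps < #|F|%:R - 1.
    apply: lt_le_trans (archi_boundP _) _; first by rewrite divr_ge0 // ltW.
    by rewrite lerBrDr natr1 ler_nat.
  rewrite lerD2l lerN2 ler_pdivrMr; last by apply: le_lt_trans q_gt; rewrite divr_ge0 // ltW.
  by rewrite mulrC -ler_pdivrMr // ltW.
move=> Rs good; do !split=> //; [exact: unambiguous_reliable|exact: scheme_secure].
Qed.
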